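(* For all integers $t$ and $\Delta$, the class of finite graphs of layered treewidth at most $t$ and maximum degree at most $\Delta$ has asymptotic dimension at most $2$.
   Context: A layering of $G$ is a partition $L_0,L_1,\dots$ of $V(G)$ such that the ends of every edge lie in the same layer or in consecutive layers. $G$ has layered treewidth at most $t$ if it has a tree-decomposition and a layering such that each bag intersects each layer in at most $t$ vertices. Graphs are metric spaces with the shortest-path distance. For a metric space $(X,d)$, a family $\mathcal U$ of subsets is $D$-bounded if every member has diameter at most $D$, and $r$-disjoint if points in different members are at distance $>r$. A function $D:\mathbb{R}^+\to\mathbb{R}^+$ is an $n$-dimensional control function for $X$ if for every $r>0$ there is a cover $\mathcal U=\mathcal U_1\cup\dots\cup\mathcal U_{n+1}$ of $X$ with each $\mathcal U_i$ $r$-disjoint and each member $D(r)$-bounded; a class has asymptotic dimension at most $n$ if one such function works for all its members. *)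

(* Defs.v *)
From Stdlib Require Import Reals.
From mathcomp Require Import all_boot.

Set Implicit Arguments.
Unset Strict Implicit.
Unset Printing Implicit Defensive.

Definition simple_graph (V : finType) (e : rel V) : Prop :=
  symmetric e /\ irreflexive e.

(* Shortest-path distance d_G(x,y) <= d : some walk from x to y of length <= d.
   (Vertices in different components are at distance +infinity.) *)
Definition dist_le (V : finType) (e : rel V) (x y : V) (d : R) : Prop :=
  exists p : seq V, path e x p /\ last x p = y /\ Rle (INR (size p)) d.

Definition D_bounded (V : finType) (e : rel V) (F : {set {set V}}) (D : R) : Prop :=
  forall U, U \in F -> forall x y, x \in U -> y \in U -> dist_le e x y D.

Definition r_disjoint (V : finType) (e : rel V) (F : {set {set V}}) (r : R) : Prop :=
  forall U U', U \in F -> U' \in F -> U != U' ->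
  forall x y, x \in U -> y \in U' -> ~ dist_le e x y r.

Definition control_function (V : finType) (e : rel V) (n : nat) (D : R -> R) : Prop :=
  forall r : R, Rlt 0 r ->
  exists F : 'I_n.+1 -> {set {set V}},
    (forall x : V, exists i U, U \in F i /\ x \in U) /\
    (forall i, r_disjoint e (F i) r /\ D_bounded e (F i) (D r)).

(* A class of finite graphs (given as a predicate) has asymptotic dimension
   at most n. D : R^+ -> R^+ is modelled as D : R -> R positive on positives. *)
Definition asdim_class_le (C : forall V : finType, rel V -> Prop) (n : nat) : Prop :=
  exists D : R -> R, (forall r, Rlt 0 r -> Rlt 0 (D r)) /\
    forall (V : finType) (e : rel V), C V e -> control_function e n D.

Definition is_tree (T : finType) (eT : rel T) : Prop :=
  simple_graph eT /\ 0 < #|T| /\ (forall a b : T, connect eT a b) /\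
  (forall s : seq T, 2 < size s -> uniq s -> ~~ cycle eT s).

Definition tree_decomposition (V : finType) (e : rel V)
    (T : finType) (eT : rel T) (B : T -> {set V}) : Prop :=
  is_tree eT /\
  (forall v : V, exists x : T, v \in B x) /\
  (forall u v : V, e u v -> exists x : T, (u \in B x) && (v \in B x)) /\
  (forall (v : V) (x y : T), v \in B x -> v \in B y ->
     connect [rel a b | [&& eT a b, v \in B a & v \in B b]] x y).

(* A layering L_0, L_1, ... given by the layer index of each vertex: vertex v
   lies in L_(layer v); ends of every edge lie in the same or consecutive layers. *)
Definition layering (V : finType) (e : rel V) (layer : V -> nat) : Prop :=
  forall u v : V, e u v -> (layer u <= (layer v).+1) && (layer v <= (layer u).+1).

Definition layered_tw_le (V : finType) (e : rel V) (t : nat) : Prop :=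
  exists (T : finType) (eT : rel T) (B : T -> {set V}) (layer : V -> nat),
    tree_decomposition e eT B /\ layering e layer /\
    forall (x : T) (i : nat), #|[set v in B x | layer v == i]| <= t.

Definition max_degree_le (V : finType) (e : rel V) (Delta : nat) : Prop :=
  forall v : V, #|[set w | e v w]| <= Delta.

(* Main.v *)
Require Import Defs.
From Stdlib Require Import Reals ZArith.
From mathcomp Require Import all_boot zify.

(** Cut the layers into strips of [n + 1] consecutive layers, where [n] is the
    scale at hand. The power graph of a strip has bounded degree and a
    tree-decomposition with bounded bags, so it has a tree-partition into bounded
    parts, and the parity of the depth of the parts gives a 2-colouring [f] of the
    strip with bounded monochromatic components. A vertex [v] of strip [j]
    receives the colour [j + f v] modulo 3, so a monochromatic chain of step [n]
    stays in two neighbouring strips. Strips are 2-coloured at one of three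
    scales, according to [j] modulo 3, each scale exceeding the diameters of the
    components obtained at the smaller ones; hence in two neighbouring strips a
    chain meets at most one component of the coarser strip, and only components
    of the finer strip that are close to it. *)

Set Implicit Arguments.
Unset Strict Implicit.
Unset Printing Implicit Defensive.

(** * Reachability and counting *)

Lemma connect_invariant (T : finType) (e : rel T) (P : T -> Prop) x y :
  (forall a b, P a -> e a b -> P b) -> P x -> connect e x y -> P y.
Proof.
move=> Pe Px /connectP[p]; elim: p x Px => [|z p IHp] x Px /= => [_ -> //|].
by case/andP=> exz /IHp; apply; apply: Pe exz.
Qed.

Lemma card_bigcup_leq (I V : finType) (A : {pred I}) (F : I -> {set V}) k :
  (forall i, i \in A -> #|F i| <= k) -> #|\bigcup_(i in A) F i| <= #|A| * k.
Proof.
move=> le_k; rewrite -sum_nat_const.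
apply: (big_rec2 (fun (U : {set V}) m => #|U| <= m)); first by rewrite cards0.
move=> i U m /le_k le_i le_U; apply: leq_trans (leq_card_setU _ _) _.
exact: leq_add.
Qed.

(** * Distances *)

(** A boolean form of [dist_le] at integer radii. Walks may pause, which makes the relation monotone
    in [n]. *)
Fixpoint dle (V : finType) (e : rel V) (n : nat) : rel V := fun x y =>
  if n is m.+1 then [exists z, dle e m x z && ((z == y) || e z y)] else x == y.

Section Distance.
Variables (V : finType) (e : rel V).

Lemma dle0 x : dle e 0 x x. Proof. exact: eqxx. Qed.

Lemma dleSE n x y :
  dle e n.+1 x y = [exists z, dle e n x z && ((z == y) || e z y)].
Proof. by []. Qed.

Lemma dleS n x y z : dle e n x y -> e y z -> dle e n.+1 x z.
Proof.
by move=> xy yz; rewrite dleSE; apply/existsP; exists y; rewrite xy yz orbT.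
Qed.

Lemma dle_leq m n x y : m <= n -> dle e m x y -> dle e n x y.
Proof.
move=> /subnKC <-; elim: (n - m) => [|k IHk] xy; first by rewrite addn0.
by rewrite addnS dleSE; apply/existsP; exists y; rewrite IHk ?eqxx.
Qed.

Lemma dle_refl n x : dle e n x x.
Proof. exact: dle_leq (leq0n n) (dle0 x). Qed.

Lemma dle_trans m n x y z :
  dle e m x y -> dle e n y z -> dle e (m + n) x z.
Proof.
move=> xy; elim: n z => [|n IHn] z; first by move=> /eqP <-; rewrite addn0.
rewrite dleSE => /existsP[u] /andP[/IHn xu /predU1P[<-|uz]]; rewrite addnS.
  exact: dle_leq xu.
exact: dleS xu uz.
Qed.

Lemma dle_sym n : symmetric e -> symmetric (dle e n).
Proof.
move=> e_sym; suff dleC x y : dle e n x y -> dle e n y x.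
  by move=> x y; apply/idP/idP; apply: dleC.
elim: n x y => [|n IHn] x y; first by move=> /eqP ->; apply: dle0.
rewrite dleSE => /existsP[u] /andP[/IHn ux /predU1P[<-|uy]]; first exact: dle_leq ux.
rewrite -add1n; apply: dle_trans ux; apply: (dleS (dle0 y)).
by rewrite e_sym.
Qed.

Lemma dle_pathP n x y :
  (exists p, [/\ path e x p, last x p = y & size p <= n]) <-> dle e n x y.
Proof.
split=> [[p [+ + le_pn]]|].
  move=> ep <-; apply: dle_leq le_pn _.
  elim/last_ind: p ep => [|p z IHp] /=; first by rewrite eqxx.
  rewrite rcons_path last_rcons size_rcons => /andP[/IHp xp pz].
  exact: dleS xp pz.
elim: n y => [|n IHn] y; first by move=> /eqP ->; exists [::].
rewrite dleSE => /existsP[u] /andP[/IHn[p [ep pu le_pn]] /predU1P[<-|uy]].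
  by exists p; split=> //; apply: leqW.
by exists (rcons p y); rewrite rcons_path last_rcons size_rcons ep pu uy.
Qed.

Lemma dist_leP x y n : dist_le e x y (INR n) <-> dle e n x y.
Proof.
rewrite -dle_pathP; split=> [[p [ep [py le_pn]]]|[p [ep py le_pn]]].
  by exists p; split=> //; apply/leP; apply: INR_le.
by exists p; do 2!split=> //; apply: le_INR; apply/leP.
Qed.

Lemma card_dle Delta n x :
  max_degree_le e Delta -> #|[set y | dle e n x y]| <= Delta.+1 ^ n.
Proof.
move=> degD; elim: n => [|n IHn].
  by rewrite (_ : [set y | _] = [set x]) ?cards1 //; apply/setP=> y;
     rewrite !inE eq_sym.
have sub : [set y | dle e n.+1 x y] \subset
    \bigcup_(z in [set y | dle e n x y]) (z |: [set w | e z w]).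
  apply/subsetP=> y; rewrite inE dleSE => /existsP[z /andP[xz zy]].
  by apply/bigcupP; exists z; rewrite !inE // eq_sym.
apply: leq_trans (subset_leq_card sub) _.
apply: leq_trans (card_bigcup_leq (k := Delta.+1) _) _ => [z _|].
  by apply: leq_trans (leq_card_setU _ _) _; rewrite cards1 add1n ltnS.
by rewrite expnSr leq_mul2r IHn orbT.
Qed.

Lemma layering_dle layer n x y :
  layering e layer -> dle e n x y ->
  (layer x <= layer y + n) && (layer y <= layer x + n).
Proof.
move=> lay; elim: n y => [|n IHn] y; first by move=> /eqP ->; rewrite addn0 leqnn.
rewrite dleSE => /existsP[z] /andP[/IHn + /predU1P[<-|/lay]]; lia.
Qed.

(** A repetition-free [R]-path stays in the component of [x], so it has fewer than [w] steps, each
    of length at most [r]. *)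
Lemma connect_dle (R : rel V) r w x y :
  subrel R (dle e r) -> #|[set z | connect R x z]| <= w ->
  connect R x y -> dle e (w * r) x y.
Proof.
move=> subR le_w /connectP[p /shortenP[q Rq q_uniq _] ->{y}].
have size_q : size (x :: q) <= w.
  apply: leq_trans le_w; rewrite -(card_uniqP q_uniq).
  apply/subset_leq_card/subsetP=> z zq; rewrite inE.
  exact: (path_connect Rq zq).
have xq : dle e (size q * r) x (last x q).
  elim: q x Rq {q_uniq le_w size_q} => [|z q IHq] x /=; first by move=> _; apply: (dle_refl 0).
  case/andP=> /subR xz /IHq zq; rewrite mulSn; exact: dle_trans xz zq.
by apply: dle_leq xq; rewrite leq_mul2r (ltnW size_q) orbT.
Qed.

End Distance.

(** * Rooted trees *)

(** A path from [y] to [z] avoiding [x] would close up through [x] into a cycle. *)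
Lemma acyclic_neighbours (T : finType) (eT : rel T) x y z :
  simple_graph eT ->
  (forall s : seq T, 2 < size s -> uniq s -> ~~ cycle eT s) ->
  eT x y -> eT x z -> y != z ->
  ~~ connect [rel a b | [&& eT a b, a != x & b != x]] y z.
Proof.
move=> [eT_sym eT_irr] acyc xy xz yz; apply/negP=> /connectP[p].
case/shortenP=> q eq q_uniq _ def_z.
have xq : x \notin y :: q.
  rewrite inE negb_or; apply/andP; split.
    by apply: contraTneq xy => <-; rewrite eT_irr.
  elim: q y eq {q_uniq def_z xy yz} => //= u q IHq y /andP[/and3P[_ _ ux] /IHq].
  by rewrite inE negb_or eq_sym ux.
have: ~~ cycle eT (x :: y :: q).
  apply: acyc; last by rewrite cons_uniq xq.
  by case: q def_z {eq q_uniq xq} yz => //= <-; rewrite eqxx.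
rewrite /= xy rcons_path -def_z eT_sym xz andbT /=.
by rewrite (sub_path _ eq) // => a b /and3P[].
Qed.

(** Making the root its own parent keeps [par] total, so that ancestry is [fconnect par]; [d] need
    only drop strictly towards the root. *)
Definition rooting (T : finType) (eT : rel T) (root : T) (par : T -> T)
    (d : T -> nat) : Prop :=
  [/\ par root = root,
      forall x, x != root -> d (par x) < d x
    & forall x y, eT x y -> y = par x /\ d y < d x \/ x = par y /\ d x < d y].

(** [d] is the distance from an arbitrary root and [par] picks a neighbour nearer to it; acyclicity
    makes this neighbour the only one that is not farther from the root. *)
Lemma tree_rooting (T : finType) (eT : rel T) :
  is_tree eT -> exists root par d, @rooting T eT root par d.
Proof.
move=> [sgT [/card_gt0P[root _] [connT acyc]]]; have [eT_sym eT_irr] := sgT.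
have ex x : exists k, dle eT k root x.
  apply: (connect_invariant (P := fun y => exists k, dle eT k root y))
    (connT root x).
    by move=> a b [k ka] ab; exists k.+1; apply: dleS ka ab.
  by exists 0; apply: dle0.
pose d x := ex_minn (ex x).
have d_min k x : dle eT k root x -> d x <= k.
  by rewrite /d; case: ex_minnP => m _; apply.
have lower x : x != root -> exists y, eT x y && (d y < d x).
  move=> x_root; rewrite /(d x); case: ex_minnP => -[|k].
    by move=> /eqP rx; rewrite rx eqxx in x_root.
  rewrite dleSE => /existsP[z] /andP[rz /predU1P[<- /(_ _ rz)|zx _]]; first by rewrite ltnn.
  by exists z; rewrite eT_sym zx ltnS d_min.
pose par x := if x == root then x else odflt x [pick y | eT x y && (d y < d x)].
have parP x : x != root -> eT x (par x) && (d (par x) < d x).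
  rewrite /par => x_root; rewrite (negPf x_root); case: pickP => //= no.
  by have [y] := lower x x_root; rewrite no.
have d0 x : d x = 0 -> x = root.
  move=> dx; apply/eqP; apply: contraT => /parP /andP[_]; by rewrite dx.
pose off x := [rel a b | [&& eT a b, a != x & b != x]].
have off_sym x : connect_sym (off x).
  by apply: sym_connect_sym => // a b /=; rewrite eT_sym; case: (eT b a); rewrite //= andbC.
(* Climbing from [y], depths fall strictly below [d x] after the first step, so [x] is never met. *)
have to_root x y : y != x -> d y <= d x -> connect (off x) y root.
  have [n] := ubnP (d y); elim: n y => // n IHn y le_n yx yd.
  have [->//|/parP/andP[yp dp]] := eqVneq y root.
  have px : par y != x by apply: contraTneq dp => ->; rewrite -leqNgt.
  apply: connect_trans (IHn _ _ px _); last 2 first.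
  - exact: leq_trans dp _.
  - exact: leq_trans (ltnW dp) yd.
  by apply: connect1; rewrite /= yp yx.
have edge x y : eT x y -> d y <= d x -> y = par x /\ d y < d x.
  move=> xy le_d; have yx : y != x.
    by apply: contraTneq xy => ->; rewrite eT_irr.
  have x_root : x != root.
    apply: contraNneq yx => x_root; apply/eqP; rewrite x_root; apply: d0.
    apply/eqP; rewrite -leqn0; apply: leq_trans le_d _; rewrite x_root.
    exact/d_min/dle0.
  have /andP[xp dp] := parP x x_root.
  have px : par x != x by apply: contraTneq xp => ->; rewrite eT_irr.
  suff /eqP yp : y == par x by split=> //; rewrite yp.
  apply: contraT => /(acyclic_neighbours sgT acyc xy xp) /negP[].
  apply: connect_trans (to_root x y yx le_d) _; rewrite off_sym.
  by apply: to_root => //; apply: ltnW.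
exists root, par, d; split.
- by rewrite /par eqxx.
- by move=> x /parP/andP[].
move=> x y xy; have /orP[le_d|le_d] := leq_total (d y) (d x).
  by left; apply: edge.
by right; apply: edge; rewrite 1?eT_sym.
Qed.

Section RootedTree.
Variables (T : finType) (eT : rel T) (root : T) (par : T -> T) (d : T -> nat).
Hypothesis rootT : rooting eT root par d.

Local Notation "x ~> y" := (fconnect par x y) (at level 70).

Lemma anc_depth x y : x ~> y -> x = y \/ d y < d x.
Proof.
have [par_root par_lt _] := rootT; move: y => y.
apply: (connect_invariant (P := fun z => x = z \/ d z < d x)); last by left.
move=> a b xa /eqP <-; have [a_root|/par_lt lt_a] := eqVneq a root.
  by rewrite a_root par_root -a_root.
by right; case: xa => [->//|]; apply: ltn_trans.
Qed.

Lemma anc_anti x y : x ~> y -> y ~> x -> x = y.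
Proof. by case/anc_depth=> // lt_yx /anc_depth[//|]; rewrite ltnNge ltnW. Qed.

Lemma anc_root x : x ~> root.
Proof.
have [_ par_lt _] := rootT; have [n] := ubnP (d x); elim: n x => // n IHn x le_n.
have [->//|/par_lt lt_x] := eqVneq x root; rewrite fconnect_eqVf IHn ?orbT //.
exact: leq_trans lt_x _.
Qed.

Lemma anc_total x y z : x ~> y -> x ~> z -> y ~> z \/ z ~> y.
Proof.
move=> /iter_findex <- /iter_findex <-.
set i := findex _ _ _; set j := findex _ _ _.
have /orP[/subnK <-|/subnK <-] := leq_total i j; rewrite iterD.
  by left; apply: fconnect_iter.
by right; apply: fconnect_iter.
Qed.

Definition is_lca a b c :=
  [/\ a ~> c, b ~> c & forall z, a ~> z -> b ~> z -> c ~> z].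

Definition lca_closed (A : {set T}) :=
  forall a b, a \in A -> b \in A -> exists2 c, c \in A & is_lca a b c.

Lemma is_lcaC a b c : is_lca a b c -> is_lca b a c.
Proof. by case=> ac bc lca; split=> // z bz az; apply: lca. Qed.

Lemma is_lca_anc a b : a ~> b -> is_lca a b b.
Proof. by split. Qed.

(* Besides [x], only the lowest ancestor [m] of [x] lying above a point of [A]
   has to be added. *)
Lemma lca_closedU1 x (A : {set T}) :
  lca_closed A -> exists m, lca_closed (x |: (m |: A)).
Proof.
have [->|[a1 Aa1]] := set_0Vmem A => closedA.
  exists x => a b; rewrite !inE !orbF !orbb => /eqP -> /eqP ->.
  by exists x; rewrite ?inE ?eqxx //; apply: is_lca_anc.
pose P k := [exists a in A, a ~> iter k par x].
have exP : exists k, P k.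
  have := anc_root x => /iter_findex xr; exists (findex par x root).
  by apply/existsP; exists a1; rewrite Aa1 xr anc_root.
have [k /exists_inP[a0 Aa0 a0m] k_min] := ex_minnP exP.
set m := iter k par x in a0m; exists m.
have xm : x ~> m by apply: fconnect_iter.
have m_anc a z : a \in A -> a ~> z -> x ~> z -> m ~> z.
  move=> Aa az xz; have zE := iter_findex xz.
  have Pz : P (findex par x z) by apply/exists_inP; exists a; rewrite ?zE.
  by rewrite -zE -(subnK (k_min _ Pz)) iterD fconnect_iter.
(* The answer is the higher of [m] and the lca [c] of [a0] and [a]; these are comparable, both being
   ancestors of [a0]. *)
have lca_new a y : a \in A -> x ~> y -> y ~> m ->
    exists2 c, c \in (x |: (m |: A)) & is_lca y a c.
  move=> Aa xy ym; have [c Ac [a0c ac c_low]] := closedA _ _ Aa0 Aa.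
  have [mc|cm] := anc_total a0m a0c.
    exists c; rewrite ?inE ?Ac ?orbT //; split=> // [|z yz az].
      exact: connect_trans mc.
    apply: c_low (az); apply: connect_trans a0m _.
    by apply: m_anc Aa az _; apply: connect_trans yz.
  exists m; rewrite ?inE ?eqxx ?orbT //; split=> // [|z yz az].
    exact: connect_trans cm.
  by apply: m_anc Aa az _; apply: connect_trans yz.
have inU y : y \in (x |: (m |: A)) -> (x ~> y /\ y ~> m) \/ y \in A.
  by rewrite !inE => /or3P[/eqP ->|/eqP ->|->]; [left|left|right].
have lca_two y y' : x ~> y -> y ~> m -> y' = x \/ y' = m ->
    y \in (x |: (m |: A)) -> exists2 c, c \in (x |: (m |: A)) & is_lca y y' c.
  move=> xy ym [->|->] Uy; first by exists y => //; apply/is_lcaC/is_lca_anc.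
  by exists m; rewrite ?inE ?eqxx ?orbT //; apply: is_lca_anc.
move=> a b Ua Ub; case: (inU _ Ua) => [[xa am]|Aa]; last first.
  case: (inU _ Ub) => [[xb bm]|Ab].
    by have [c Uc /is_lcaC] := lca_new a b Aa xb bm; exists c.
  by have [c Ac] := closedA _ _ Aa Ab; exists c; rewrite // !inE Ac !orbT.
have [Ab|Ab] := boolP (b \in A); first exact: lca_new.
apply: lca_two => //; move: Ub; rewrite !inE (negPf Ab) orbF.
by case/orP=> /eqP; [left|right].
Qed.

(** Points of [S] are inserted one at a time, each bringing at most one extra node: hence the factor
    2. *)
Lemma lca_closure (S : {set T}) :
  exists A : {set T}, [/\ S \subset A, #|A| <= #|S| * 2 & lca_closed A].
Proof.
have [n] := ubnP #|S|; elim: n S => // n IHn S le_n.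
have [->|[x Sx]] := set_0Vmem S.
  by exists set0; rewrite cards0; split=> // a b; rewrite inE.
have cardS := cardsD1 x S; rewrite Sx add1n in cardS.
have [|A [SA cardA /(lca_closedU1 x)[m closedA]]] := IHn (S :\ x).
  by rewrite -ltnS -cardS.
exists (x |: (m |: A)); split=> //.
  by rewrite -(setD1K Sx) setUS //; apply: subset_trans SA (subsetUr _ _).
rewrite !cardsU1 cardS; move: cardA; lia.
Qed.

(* [q] is the top of the component of [y] in the subforest induced by [X]. *)
Definition top_in (X : {set T}) y q :=
  [/\ y ~> q, forall z, y ~> z -> z ~> q -> z \in X
    & q = root \/ par q \notin X].

Lemma top_in_exists (X : {set T}) y : y \in X -> exists q, top_in X y q.
Proof.
have [_ par_lt _] := rootT.
have [n] := ubnP (d y); elim: n y => // n IHn y le_n Xy.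
have [y_root|/par_lt lt_y] := eqVneq y root.
  by exists y; split=> //; [move=> z yz /(anc_anti yz) <- | left].
have [Xp|Xp] := boolP (par y \in X); last first.
  by exists y; split=> //; [move=> z yz /(anc_anti yz) <- | right].
have [|q [pq Xq q_top]] := IHn _ _ Xp; first exact: leq_trans lt_y _.
exists q; split=> //; first by rewrite fconnect_eqVf pq orbT.
by move=> z; rewrite fconnect_eqVf => /predU1P[<-//|]; apply: Xq.
Qed.

Lemma top_in_edge (X : {set T}) y y' q :
  eT y y' -> y' \in X -> top_in X y q -> top_in X y' q.
Proof.
have [par_root _ edgeT] := rootT.
move=> /edgeT[[-> lt_d]|[-> lt_d]] Xy' [yq Xq q_top].
  have y_neq : y != q.
    apply: contraTneq Xy' => y_q; rewrite y_q.
    case: q_top => // q_root; move: lt_d.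
    by rewrite y_q q_root par_root ltnn.
  split=> //; last first.
    by move=> z pz; apply: Xq; rewrite fconnect_eqVf pz orbT.
  by move: yq; rewrite fconnect_eqVf (negPf y_neq).
split=> //; first by rewrite fconnect_eqVf yq orbT.
by move=> z; rewrite fconnect_eqVf => /predU1P[<-//|]; apply: Xq.
Qed.

Lemma top_in_connect (X : {set T}) (R : rel T) y y' q :
  (forall a b, R a b -> eT a b /\ b \in X) ->
  connect R y y' -> top_in X y q -> top_in X y' q.
Proof.
move=> subR yy' yq; move: yy'.
apply: (connect_invariant (P := fun z => top_in X z q)) => // a b aq.
by case/subR=> ab Xb; apply: top_in_edge aq.
Qed.

(** * Separation by two bags *)

Section Separation.
Variables (V : finType) (e : rel V) (B : T -> {set V}).
Hypothesis edge_bag : forall u v, e u v -> exists x, (u \in B x) && (v \in B x).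
Hypothesis connect_bag : forall v x y, v \in B x -> v \in B y ->
  connect [rel a b | [&& eT a b, v \in B a & v \in B b]] x y.

(** The bags meeting [C] lie in one component of the tree minus [A], with top [q]. The subtree of
    bags of [v] meets this component and [A], so it leaves the component upwards through [par q], or
    downwards; lca-closure makes all nodes of [A] below [q] descend from a single one, [a2]. *)
Lemma two_bag_separation (A : {set T}) (C : {set V}) :
  lca_closed A ->
  {in C &, forall u v, connect [rel a b | [&& e a b, a \in C & b \in C]] u v} ->
  (forall a, a \in A -> [disjoint B a & C]) ->
  exists a1 a2, forall u v a,
    u \in C -> e u v -> a \in A -> v \in B a -> v \in B a1 :|: B a2.
Proof.
move=> closedA connC avoidA.
have [/exists_inP[u0 Cu0 /existsP[x0 u0x0]]|/exists_inPn no] :=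
    boolP [exists u in C, exists x, u \in B x]; last first.
  (* No vertex of [C] lies in a bag, so no edge starts in [C] and any two nodes will do. *)
  exists root, root => u v a Cu /edge_bag[x /andP[ux _]].
  by have /existsP[] := no u Cu; exists x.
have bagA u x : u \in C -> u \in B x -> x \in ~: A.
  rewrite inE => Cu ux; apply/negP=> /avoidA /pred0P /(_ u) /=.
  by rewrite ux Cu.
have [q x0q] := top_in_exists (bagA _ _ Cu0 u0x0).
have top_bag u x y : u \in C -> u \in B x -> u \in B y ->
    top_in (~: A) x q -> top_in (~: A) y q.
  move=> Cu ux uy; apply: top_in_connect (connect_bag ux uy) => a b /and3P[-> _].
  by move/(bagA _ _ Cu).
have topC u x : u \in C -> u \in B x -> top_in (~: A) x q.
  move=> Cu; move: x.
  pose P u := forall x, u \in B x -> top_in (~: A) x q.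
  apply: (connect_invariant (P := P)) (connC _ _ Cu0 Cu).
    move=> a b Pa /and3P[/edge_bag[z /andP[az bz]] _ Cb] x bx.
    exact: top_bag Cb bz bx (Pa _ az).
  by move=> x u0x; apply: top_bag u0x0 u0x x0q.
(* [t] is the top of the subtree of bags containing [v], hence an ancestor of all of them. *)
have upward u v : u \in C -> e u v -> exists y t,
    [/\ u \in B y, v \in B y & top_in [set x | v \in B x] y t].
  move=> Cu /edge_bag[y /andP[uy vy]].
  have [|t yt] := @top_in_exists [set x | v \in B x] y; first by rewrite inE.
  by exists y, t.
pose low a := (a \in A) && (a ~> q).
(* With no node of [A] below [q], the subtree of [v] must pass through [par q]; the second node is
   arbitrary. *)
have [a0 low0|no_low] := pickP low; last first.
  exists (par q), root => u v a Cu uv Aa va.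
  have [y [t [uy vy yt]]] := upward u v Cu uv.
  have [yq _ _] := topC u y Cu uy.
  have at_ : top_in [set x | v \in B x] a t.
    by apply: top_in_connect (connect_bag vy va) yt => b c /and3P[-> _ ?]; rewrite inE.
  have tq_no : ~ t ~> q.
    move=> tq; have := no_low a; rewrite /low Aa; case: at_ => at_ _ _.
    by rewrite (connect_trans at_ tq).
  case: yt => yt Xt _; have [qt|//] := anc_total yq yt.
  move: qt; rewrite fconnect_eqVf => /predU1P[q_t|pt]; first by case: tq_no; rewrite q_t.
  have := Xt (par q); rewrite !inE => -> //.
  by apply: connect_trans yq (fconnect1 _ _).
have [a2 /andP[Aa2 a2q] a2_min] := arg_minnP d low0.
exists (par q), a2 => u v a Cu uv Aa va.
have [y [t [uy vy yt]]] := upward u v Cu uv.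
have [yq A_yq _] := topC u y Cu uy.
have [at_ Xa _] : top_in [set x | v \in B x] a t.
  by apply: top_in_connect (connect_bag vy va) yt => b c /and3P[-> _ ?]; rewrite inE.
(* If the subtree of [v] stays below [q], its path from [a] up to [t] contains [a2]: were [t] below
   [a2], a node of [A] would lie between [y] and [q]. *)
rewrite inE; have case_tq : t ~> q -> v \in B a2.
  move=> tq; have aq := connect_trans at_ tq.
  have [c Ac [ac a2c c_low]] := closedA _ _ Aa Aa2.
  have a2_c : a2 = c.
    have := a2_min c; rewrite /low Ac c_low // => /(_ isT).
    by case: (anc_depth a2c) => // lt_c; rewrite leqNgt lt_c.
  have aa2 : a ~> a2 by rewrite a2_c.
  have [ta2|a2t] := anc_total at_ aa2.
    have := A_yq a2; rewrite inE Aa2; case: yt => yt _ _.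
    by move=> /(_ (connect_trans yt ta2) a2q).
  by have := Xa a2; rewrite inE; apply.
case: yt => yt Xt _; have [|tq] := anc_total yq yt; last by rewrite case_tq ?orbT.
rewrite fconnect_eqVf => /predU1P[q_t|pt]; first by rewrite case_tq ?orbT // q_t.
have := Xt (par q); rewrite !inE => -> //.
by apply: connect_trans yq (fconnect1 _ _).
Qed.

End Separation.
End RootedTree.

(** * Two-colouring graphs of bounded treewidth and degree *)

Definition mono (V : finType) (e : rel V) (C : {set V}) (f : V -> bool) : rel V :=
  [rel a b | [&& e a b, a \in C, b \in C & f a == f b]].

Section TwoColouring.
Variables (V : finType) (e : rel V) (T : finType) (eT : rel T) (B : T -> {set V}).
Variables (w Delta : nat) (D : {set V}).
Hypothesis e_sym : symmetric e.
Hypothesis treeT : is_tree eT.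
Hypothesis edge_bag : forall u v, e u v -> exists x, (u \in B x) && (v \in B x).
Hypothesis connect_bag : forall v x y, v \in B x -> v \in B y ->
  connect [rel a b | [&& eT a b, v \in B a & v \in B b]] x y.
Hypothesis cover_bag : forall v, v \in D -> exists x, v \in B x.
Hypothesis card_bag : forall x, #|B x| <= w.
Hypothesis deg : max_degree_le e Delta.

(** The number of neighbours of the vertices in two bags. *)
Let K := 2 * w * Delta.

(* A tree-partition, built greedily: the part [P] containing [S] is the trace
   of an lca-closed set of bags, and each component of what remains sees at
   most two bags of [P], so that its vertices next to [P] are few enough to
   serve as the next [S]. Parts are coloured by the parity of their depth. *)
Lemma two_colouring_from (C S : {set V}) (b : bool) :
  C \subset D -> S \subset C -> #|S| <= K ->
  exists f : V -> bool, {in S, forall v, f v = b} /\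
    {in C, forall x, #|[set y | connect (mono e C f) x y]| <= K.+1 * 2 * w}.
Proof.
have [root [par [d rootT]]] := tree_rooting treeT.
have [n] := ubnP #|C|; elim: n C S b => // n IHn C S b le_n CD SC cardS.
have [C0|[v0 Cv0]] := set_0Vmem C.
  by exists (fun=> b); split=> // x; rewrite C0 inE.
pose node v := odflt root [pick x | v \in B x].
have nodeP v : v \in C -> v \in B (node v).
  move=> /(subsetP CD) /cover_bag[x vx]; rewrite /node.
  by case: pickP => [//|/(_ x)]; rewrite vx.
(* Adding [v0] makes the part [P] non-empty even when [S] is empty, so that the recursion is on
   smaller sets; this accounts for [K.+1] instead of [K]. *)
have S0C : v0 |: S \subset C by rewrite subUset sub1set Cv0.
have [A [nodeA cardA closedA]] := lca_closure rootT (node @: (v0 |: S)).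
pose P := C :&: \bigcup_(a in A) B a.
have S0P : v0 |: S \subset P.
  rewrite subsetI S0C; apply/subsetP=> v Sv; apply/bigcupP; exists (node v).
    by apply: (subsetP nodeA); apply: imset_f.
  exact: nodeP (subsetP S0C _ Sv).
have PC : P \subset C by apply: subsetIl.
have cardP : #|P| <= K.+1 * 2 * w.
  apply: leq_trans (subset_leq_card (subsetIr _ _)) _.
  apply: leq_trans (card_bigcup_leq (fun a _ => card_bag a)) _.
  rewrite leq_mul2r; apply/orP; right; apply: leq_trans cardA _.
  rewrite leq_mul2r; apply/orP; right; apply: leq_trans (leq_imset_card _ _) _.
  by apply: leq_trans (leq_card_setU _ _) _; rewrite cards1 add1n ltnS.
pose e' : rel V := fun a c => [&& e a c, a \in C :\: P & c \in C :\: P].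
have e'_sym : connect_sym e'.
  by apply: sym_connect_sym => a c; rewrite /e' e_sym; congr (_ && _); apply: andbC.
pose comp v := [set u in C :\: P | connect e' v u].
have comp_sub v : comp v \subset C :\: P by apply/subsetP=> u; rewrite inE => /andP[].
pose bd v := [set u in comp v | [exists p in P, e p u]].
have card_bd v : #|bd v| <= K.
  have comp_conn : {in comp v &, forall u u',
      connect [rel a c | [&& e a c, a \in comp v & c \in comp v]] u u'}.
    move=> u u' vu; have /setIdP[_ cvu] := vu; move=> /setIdP[_ cvu'].
    have : connect e' u u' by apply: connect_trans cvu'; rewrite e'_sym.
    pose Q z := z \in comp v /\
      connect [rel a c | [&& e a c, a \in comp v & c \in comp v]] u z.
    suff step a c : Q a -> e' a c -> Q c.
      by case/(connect_invariant step) => //; split.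
    move=> [va ua] ac; have /and3P[eac _ Cc] := ac.
    have vc : c \in comp v.
      have /setIdP[_ cva] := va; apply/setIdP; split=> //.
      exact: connect_trans cva (connect1 ac).
    by split=> //; apply: connect_trans ua (connect1 _); rewrite /= eac va.
  have comp_avoid a : a \in A -> [disjoint B a & comp v].
    move=> Aa; apply/pred0P=> u /=; apply/negP=> /andP[ua /(subsetP (comp_sub v))].
    by case/setDP=> Cu /negP[]; rewrite inE Cu; apply/bigcupP; exists a.
  have [a1 [a2 sep]] :=
    two_bag_separation rootT edge_bag connect_bag closedA comp_conn comp_avoid.
  have bd_sub : bd v \subset \bigcup_(p in B a1 :|: B a2) [set u | e p u].
    apply/subsetP=> u /setIdP[vu /exists_inP[p /setIP[_ /bigcupP[a Aa pa]] pu]].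
    apply/bigcupP; exists p; rewrite ?inE //.
    by rewrite -in_setU; apply: sep vu _ Aa pa; rewrite e_sym.
  apply: leq_trans (subset_leq_card bd_sub) _.
  apply: leq_trans (card_bigcup_leq (fun p _ => deg p)) _.
  rewrite leq_mul2r; apply/orP; right; apply: leq_trans (leq_card_setU _ _) _.
  by rewrite mul2n -addnn leq_add.
have ex_g v : exists g : V -> bool, {in bd v, forall u, g u = ~~ b} /\
    {in comp v, forall x,
       #|[set y | connect (mono e (comp v) g) x y]| <= K.+1 * 2 * w}.
  have compC : comp v \subset C by apply: subset_trans (comp_sub v) (subsetDl _ _).
  apply: IHn (card_bd v); last by apply/subsetP=> u /setIdP[].
    apply: leq_trans (le_n : #|C| <= n); apply: proper_card.
    apply/properP; split=> //; exists v0 => //.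
    apply/negP=> /(subsetP (comp_sub v)); rewrite inE (subsetP S0P) //.
    exact: setU11.
  exact: subset_trans CD.
have [g gP] := fin_all_exists ex_g.
(* The canonical representative of a component selects its colouring, so that all its vertices use
   the same [g]. *)
pose f u := if u \in P then b else g (fingraph.root e' u) u.
(* Neighbours of [P] outside it are boundary vertices of their component and get the other colour,
   so no monochromatic component crosses the border of [P]. *)
have f_next p u : p \in P -> u \in C -> u \notin P -> e p u -> f u = ~~ b.
  move=> Pp Cu Pu pu; rewrite /f (negPf Pu); have [+ _] := gP (fingraph.root e' u).
  apply; rewrite inE inE inE Pu Cu e'_sym connect_root /=.
  by apply/exists_inP; exists p.
exists f; split=> [v Sv|x Cx].
  by rewrite /f (subsetP S0P) // inE Sv orbT.
have [Px|Px] := boolP (x \in P).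
  apply: leq_trans cardP; apply/subset_leq_card/subsetP=> y; rewrite inE.
  apply: (connect_invariant (P := fun z => z \in P)) => // a c Pa.
  case/and4P=> ac _ Cc /eqP fac; apply: contraT => Pc.
  by have := f_next a c Pa Cc Pc ac; rewrite -fac /f Pa; case: (b).
pose r := fingraph.root e' x.
have [_ /(_ x) card_r] := gP r.
have rx : x \in comp r by rewrite inE inE Px Cx e'_sym connect_root.
apply: leq_trans (card_r rx); apply/subset_leq_card/subsetP=> y; rewrite !inE.
pose Q z := z \in comp r /\ connect (mono e (comp r) (g r)) x z.
suff step a c : Q a -> mono e C f a c -> Q c.
  by case/(connect_invariant step) => //; split.
move=> [ra xa] /and4P[ac Ca Cc /eqP fac].
have /setIdP[/setDP[_ Pa] cra] := ra.
have Pc : c \notin P.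
  apply/negP=> Pc; have := f_next c a Pc Ca Pa; rewrite e_sym => /(_ ac).
  by rewrite fac /f Pc; case: (b).
have e'ac : e' a c by apply/and3P; split=> //; apply/setDP.
have rc : c \in comp r.
  apply/setIdP; split; first by rewrite inE Pc.
  exact: connect_trans cra (connect1 e'ac).
have root_r z : z \in comp r -> fingraph.root e' z = r.
  case/setIdP=> _ /(rootP e'_sym) <-; exact: root_root.
split=> //; apply: connect_trans xa (connect1 _); apply/and4P; split=> //.
by move: fac; rewrite /f (negPf Pa) (negPf Pc) !root_r // => ->.
Qed.

Lemma two_colouring :
  exists f : V -> bool,
    {in D, forall x, #|[set y | connect (mono e D f) x y]| <= K.+1 * 2 * w}.
Proof.
have [||f [_ fP]] := @two_colouring_from D set0 true (subxx D).
- exact: sub0set.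
- by rewrite cards0.
by exists f.
Qed.

End TwoColouring.

(** * Colouring strips of consecutive layers *)

Definition comp_size (w Delta : nat) := (2 * w * Delta).+1 * 2 * w.

(** The arguments of [comp_size] bound the bags and the degree of the [r]-th power of a strip of [M]
    layers; the last factor turns steps of the power graph into distance. *)
Definition strip_diam (t Delta M r : nat) :=
  comp_size ((M + 2 * r) * t * Delta.+1 ^ r) (Delta.+1 ^ r) * r.

Section Strip.
Variables (V : finType) (e : rel V) (T : finType) (eT : rel T) (B : T -> {set V}).
Variables (layer : V -> nat) (t Delta : nat).
Hypothesis e_sym : symmetric e.
Hypothesis tdec : tree_decomposition e eT B.
Hypothesis lay : layering e layer.
Hypothesis card_layer : forall x i, #|[set v in B x | layer v == i]| <= t.
Hypothesis deg : max_degree_le e Delta.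

(* The [r]-th power of the strip inherits the tree-decomposition whose bags are
   the [r]-neighbourhoods of the old ones. *)
Lemma strip_colouring (M r j : nat) : 0 < M ->
  let S := [set v | layer v %/ M == j] in
  exists f : V -> bool, forall x y,
    connect (mono (dle e r) S f) x y -> dle e (strip_diam t Delta M r) x y.
Proof.
move=> M_gt0 S; have [treeT [coverB [edgeB connB]]] := tdec.
pose e' : rel V := fun u v => [&& dle e r u v, u \in S & v \in S].
pose B' x := [set v in S | [exists u in B x, dle e r u v]].
have e'_sym : symmetric e'.
  by move=> u v; rewrite /e' dle_sym //; congr (_ && _); apply: andbC.
have edge_bag u v : e' u v -> exists x, (u \in B' x) && (v \in B' x).
  case/and3P=> uv Su Sv; have [x ux] := coverB u; exists x.
  rewrite !inE -/S in Su Sv *; rewrite Su Sv /=.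
  by apply/andP; split; apply/exists_inP; exists u; rewrite ?dle_refl.
have connect_bag v x y : v \in B' x -> v \in B' y ->
    connect [rel a b | [&& eT a b, v \in B' a & v \in B' b]] x y.
  move=> /setIdP[Sv /exists_inP[u ux uv]] /setIdP[_ /exists_inP[u' u'y u'v]].
  set R := (X in connect X).
  have R_sym : connect_sym R.
    have [[eT_sym _] _] := treeT.
    by apply: sym_connect_sym => a b; rewrite /R /= eT_sym; congr (_ && _); apply: andbC.
  have via z x1 x2 : dle e r v z -> z \in B x1 -> z \in B x2 -> connect R x1 x2.
    move=> vz zx1 zx2; apply: connect_sub (connB _ _ _ zx1 zx2) => a b /and3P[ab za zb].
    apply: connect1; apply/and3P; split=> //; apply/setIdP; split=> //;
      by apply/exists_inP; exists z; rewrite // dle_sym.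
  have [x0 vx0] := coverB v.
  (* Along a walk from [v] of length at most [r], every bag of a visited vertex has [v] in its
     neighbourhood, and consecutive vertices share a bag. *)
  have near n z x1 : n <= r -> dle e n v z -> z \in B x1 -> connect R x0 x1.
    elim: n z x1 => [|n IHn] z x1 le_n vz.
      by move/eqP: vz => <-; apply: via vx0; apply: dle_refl.
    move: (vz); rewrite dleSE => /existsP[z' /andP[vz' /predU1P[z'z|z'z]]] zx1.
      by rewrite z'z in vz'; apply: IHn vz' zx1; apply: ltnW.
    have [x' /andP[z'x' zx']] := edgeB _ _ z'z.
    apply: connect_trans (IHn _ _ (ltnW le_n) vz' z'x') _.
    by apply: via zx' zx1; apply: dle_leq vz.
  apply: connect_trans (near r u' y _ _ u'y) => //; last by rewrite dle_sym.
  by rewrite R_sym; apply: (near r u) => //; rewrite dle_sym.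
have cover_bag v : v \in S -> exists x, v \in B' x.
  have [x vx] := coverB v; move=> Sv; exists x.
  by apply/setIdP; split=> //; apply/exists_inP; exists v; rewrite ?dle_refl.
have deg' : max_degree_le e' (Delta.+1 ^ r).
  move=> v; apply: leq_trans (card_dle r v deg); apply/subset_leq_card/subsetP=> u.
  by rewrite !inE => /and3P[].
have card_bag x : #|B' x| <= (M + 2 * r) * t * Delta.+1 ^ r.
  (* A vertex within [r] of the strip lies in one of these [M + 2 * r] layers; this survives
     truncation of the subtraction when [j * M < r]. *)
  pose U := \bigcup_(i : 'I_(M + 2 * r)) [set v in B x | layer v == j * M - r + i].
  have cardU : #|U| <= (M + 2 * r) * t.
    rewrite -[M + _]card_ord; apply: card_bigcup_leq => i _; exact: card_layer.
  have sub : B' x \subset \bigcup_(u in U) [set v | dle e r u v].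
    apply/subsetP=> v /setIdP[]; rewrite inE => /eqP Sv /exists_inP[u ux uv].
    apply/bigcupP; exists u; rewrite ?inE //.
    have ltM := ltn_pmod (layer v) M_gt0; have := divn_eq (layer v) M.
    have := layering_dle lay uv; rewrite Sv => uv_lay v_lay.
    have lt_i : layer u - (j * M - r) < M + 2 * r by lia.
    apply/bigcupP; exists (Ordinal lt_i) => //; rewrite inE ux /=; lia.
  apply: leq_trans (subset_leq_card sub) _.
  apply: leq_trans (card_bigcup_leq (fun u _ => card_dle r u deg)) _.
  by rewrite leq_mul2r cardU orbT.
have [f fP] := two_colouring e'_sym treeT edge_bag connect_bag cover_bag card_bag deg'.
exists f => x y; have [Sx|Sx] := boolP (x \in S); last first.
  case/connectP=> -[_ ->|z p /andP[/and4P[_ xS]]]; first exact: dle_refl.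
  by rewrite xS in Sx.
have e'E : mono (dle e r) S f =2 mono e' S f.
  move=> a b; apply/and4P/and4P=> [[ab Sa Sb fab]|[/and3P[ab _ _] Sa Sb fab]] //.
  by split=> //; apply/and3P.
rewrite (eq_connect e'E); apply: connect_dle (fP x Sx).
by move=> a b /and4P[/and3P[]].
Qed.

End Strip.

(** * Gluing the strips *)

Definition chain (V : finType) (e : rel V) (n : nat) (P : pred V) : rel V :=
  fun a b => [&& dle e n a b, P a & P b].

(* A chain of step [n] leaving a component of the coarse class [Pb] runs inside
   a single component of the fine class [Ps] until it comes back, hence it
   comes back to the same component of [Pb]. *)
Lemma saturated_union (V : finType) (e : rel V) (Ps Pb P : pred V) n Ds Db x y :
  symmetric e ->
  (forall z, P z -> Ps z || Pb z) ->
  (forall a b, connect (chain e n Ps) a b -> dle e Ds a b) ->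
  (forall a b, connect (chain e (Ds + 2 * n) Pb) a b -> dle e Db a b) ->
  connect (chain e n P) x y -> dle e (Db + 2 * (Ds + n)) x y.
Proof.
move=> e_sym Psb diam_s diam_b; have dC k a b : dle e k a b -> dle e k b a.
  by rewrite dle_sym.
(* Here [y] is the coarse vertex [b] itself or lies on a fine excursion leaving [b]. *)
pose right b y := y = b \/
  [/\ Ps y & exists2 a, dle e n b a & connect (chain e n Ps) a y].
(* Either the chain is still in its initial fine component, or it entered the coarse class at [b]
   and [b'] is the last coarse vertex recorded. *)
pose Inv y := Ps y /\ connect (chain e n Ps) x y \/
  exists b b', [/\ dle e (Ds + n) x b, Pb b', connect (chain e (Ds + 2 * n) Pb) b b'
                 & right b' y].
have Inv_step a b : Inv a -> chain e n P a b -> Inv b.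
  move=> Inva /and3P[ab _ /Psb /orP[Psb_|Pbb]].
    case: Inva => [[Psa xa]|[c [c' [xc Pbc' cc' c'a]]]].
      left; split=> //; apply: connect_trans xa (connect1 _); exact/and3P.
    right; exists c, c'; split=> //; right; split=> //.
    case: c'a => [<-|[Psa [a0 c'a0 a0a]]]; first by exists b.
    by exists a0 => //; apply: connect_trans a0a (connect1 _); apply/and3P.
  right; case: Inva => [[Psa xa]|[c [c' [xc Pbc' cc' c'a]]]].
    by exists b, b; split=> //; [apply: dle_trans (diam_s _ _ xa) ab | left].
  exists c, b; split=> //; last by left.
  apply: connect_trans cc' (connect1 _); apply/and3P; split=> //.
  (* An excursion costs [n] to leave, [Ds] inside the fine component and [n] to return, whence the
     coarse step [Ds + 2 * n]. *)
  case: c'a => [<-|[_ [a0 c'a0 /diam_s a0a]]]; first by apply: dle_leq ab; lia.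
  by apply: dle_leq (dle_trans c'a0 (dle_trans a0a ab)); lia.
have [Px|Px] := boolP (P x); last first.
  case/connectP=> -[_ ->|z p /andP[/and3P[_ xP]]]; first exact: dle_refl.
  by rewrite xP in Px.
have Inv_x : Inv x.
  case/orP: (Psb x Px) => [Psx|Pbx]; first by left.
  by right; exists x, x; split=> //; [apply: dle_refl | left].
case/(connect_invariant Inv_step) => // [[_ /diam_s xy]|].
  by apply: dle_leq xy; lia.
move=> [b [b' [xb _ /diam_b bb' [y_b'|[_ [a b'a /diam_s ay]]]]]].
  by rewrite y_b'; apply: dle_leq (dle_trans xb bb'); lia.
by apply: dle_leq (dle_trans xb (dle_trans bb' (dle_trans b'a ay))); lia.
Qed.

(** * Three scales and the 3-colouring *)

Section Scales.
Variables t Delta n : nat.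

Let diam := strip_diam t Delta n.+1.
(** [r1] and [r2] exceed the component diameter at each smaller scale by at least [2 * n], as
    [saturated_union] requires. *)
Let r1 := diam n + 2 * n.
Let r2 := diam n + diam r1 + 2 * n.

(** Residue 2 falls outside the list and gets the default [r2]. *)
Definition scale (j : nat) := nth r2 [:: n; r1] (j %% 3).

Definition colour_diam := 2 * (diam n + diam r1 + diam r2 + n).

Lemma scale_ge j : n <= scale j.
Proof.
rewrite /scale; case: (j %% 3) => [|[|k]] //=; first by rewrite /r1; lia.
by rewrite nth_nil /r2; lia.
Qed.

(* In a class of vertices [v] with [strip v + f v = k] for a bit [f v], one of
   the two strips has a scale exceeding the component diameter of the other. *)
Lemma scale_pair k : exists s b,
  [/\ forall (j : nat) (f : bool), j + f = k -> (j == s) || (j == b),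
      diam (scale s) + 2 * n <= scale b
    & diam (scale b) + 2 * (diam (scale s) + n) <= colour_diam].
Proof.
have scaleE j : scale j = nth r2 [:: n; r1] (j %% 3) by [].
have [k0|[k1|k2]] : k %% 3 = 0 \/ k %% 3 = 1 \/ k %% 3 = 2 by lia.
(* The preceding strip has residue 2 and is the coarser one; for [k = 0] there is none, and [2] is a
   dummy of that residue. *)
- exists k, (if k is k'.+1 then k' else 2); split.
  + by case: k {k0} => [|k] j [] /=; lia.
  + rewrite !scaleE k0 (_ : _ %% 3 = 2) /=; last by case: k k0 => //=; lia.
    rewrite /r2; lia.
  + rewrite !scaleE k0 (_ : _ %% 3 = 2) /=; last by case: k k0 => //=; lia.
    rewrite /colour_diam; lia.
- exists k.-1, k; rewrite !scaleE k1 (_ : k.-1 %% 3 = 0) /=; last by lia.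
  by split; [case: k {k1} => [|k] j []; lia | rewrite /r1; lia | rewrite /colour_diam; lia].
exists k.-1, k; rewrite !scaleE k2 (_ : k.-1 %% 3 = 1) /=; last by lia.
by split; [case: k {k2} => [|k] j []; lia | rewrite /r2; lia | rewrite /colour_diam; lia].
Qed.

(** A step of length at most [n] changes the strip by at most 1 and the bit by at most 1, so equal
    keys modulo 3 are equal; a monochromatic chain thus has a constant key and lives in the two
    strips of [scale_pair]. *)
Lemma three_colouring (V : finType) (e : rel V) :
  symmetric e -> layered_tw_le e t -> max_degree_le e Delta ->
  exists col : V -> 'I_3, forall x y,
    connect (fun a b => dle e n a b && (col a == col b)) x y ->
    dle e colour_diam x y.
Proof.
move=> e_sym [T [eT [B [layer [tdec [lay card_layer]]]]]] deg.
pose strip v := layer v %/ n.+1.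
pose S j := [set v | strip v == j].
(* Finite functions and a boolean property allow [xchoose] to select a colouring for every [j]. *)
have ex_f j : exists f : {ffun V -> bool}, [forall x, forall y,
    connect (mono (dle e (scale j)) (S j) f) x y ==> dle e (diam (scale j)) x y].
  have [f fP] := strip_colouring e_sym tdec lay card_layer deg (scale j) j (ltn0Sn n).
  exists (finfun f); apply/'forall_forallP=> x y; apply/implyP=> xy; apply: fP.
  move: xy; apply: connect_sub => a b /and4P[ab Sa Sb]; rewrite !ffunE => fab.
  by apply: connect1; apply/and4P.
pose f j := xchoose (ex_f j).
have fP j x y : connect (mono (dle e (scale j)) (S j) (f j)) x y ->
    dle e (diam (scale j)) x y.
  by move: (xchooseP (ex_f j)) => /'forall_forallP/(_ x y)/implyP.
pose key v := strip v + f (strip v) v.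
(* Within one strip a fixed key fixes the bit, so the chain is monochromatic. *)
have diam_key k j m x y : m <= scale j ->
    connect (chain e m (fun v => (key v == k) && (strip v == j))) x y ->
    dle e (diam (scale j)) x y.
  move=> le_m xy; apply: fP; move: xy; apply: connect_sub => a b.
  case/and3P=> ab /andP[/eqP ka /eqP sa] /andP[/eqP kb /eqP sb].
  apply: connect1; apply/and4P; split; rewrite ?inE ?sa ?sb //.
    exact: dle_leq ab.
  move: ka kb; rewrite /key sa sb => <- /eqP; rewrite eqn_add2l => /eqP.
  by case: (f j a); case: (f j b).
pose col v : 'I_3 := Ordinal (ltn_pmod (key v) (isT : 0 < 3)).
exists col => x y.
have same_key a b : dle e n a b -> col a == col b -> key a = key b.
  move=> ab /eqP/(congr1 val) /=; have := layering_dle lay ab.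
  have near u v : layer u <= layer v + n -> strip u <= (strip v).+1.
    move=> le_uv; rewrite -addn1 -[1](divnn n.+1) -divnDr // leq_div2r //; lia.
  case/andP=> /near near_a /near near_b; move: near_a near_b.
  by rewrite /key; case: (f _ a); case: (f _ b) => /=; lia.
have key_chain : connect (fun a b => dle e n a b && (col a == col b)) x y ->
    connect (chain e n (fun v => key v == key x)) x y.
  pose Q z := key z = key x /\ connect (chain e n (fun v => key v == key x)) x z.
  suff step a b : Q a -> dle e n a b && (col a == col b) -> Q b.
    by case/(connect_invariant step) => //; split.
  move=> [ka xa] /andP[ab cab]; have kb := same_key a b ab cab.
  split; first by rewrite -kb.
  by apply: connect_trans xa (connect1 _); rewrite /chain ab -kb ka eqxx.
move=> /key_chain xy; have [s [b [cover_sb le_sb le_diam]]] := scale_pair (key x).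
pose cls j v := (key v == key x) && (strip v == j).
apply: dle_leq le_diam _.
apply: (saturated_union (Ps := cls s) (Pb := cls b) e_sym) xy.
- by move=> z kz; rewrite /cls kz /=; apply: cover_sb (eqP kz).
- by move=> a c; apply: diam_key; apply: scale_ge.
- by move=> a c; apply: diam_key.
Qed.

End Scales.

(** * From the 3-colouring to covers *)

Theorem theorem5p6 (t Delta : nat) :
  asdim_class_le
    (fun (V : finType) (e : rel V) =>
       simple_graph e /\ layered_tw_le e t /\ max_degree_le e Delta) 2.
Proof.
(* Since [up r] exceeds [r], this rounds [r] up to an integer scale; the successor keeps the control
   function positive. *)
exists (fun r => INR (colour_diam t Delta (Z.to_nat (up r))).+1).
split=> [r _|V e [[e_sym _] [ltw deg]] r r_gt0].
  by apply: lt_0_INR; apply/ltP.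
set n := Z.to_nat (up r).
have le_rn : Rle r (INR n).
  have [up_gt _] := archimed r; rewrite INR_IZR_INZ Z2Nat.id; first exact: Rlt_le.
  by apply: le_IZR; apply: Rlt_le; apply: Rlt_trans up_gt.
have [col colP] := three_colouring n e_sym ltw deg.
pose R : rel V := fun a b => dle e n a b && (col a == col b).
have R_sym : connect_sym R.
  by apply: sym_connect_sym => a b; rewrite /R dle_sym // eq_sym.
have R_col x y : connect R x y -> col y = col x.
  by apply: (connect_invariant (P := fun z => col z = col x)) => // a b <- /andP[_ /eqP].
pose comp x := [set y | connect R x y].
(* The cover consists of the components of the colour classes at scale [n]; vertices of one colour
   at distance at most [r] share a component. *)
exists (fun i => [set comp x | x in [set x | col x == i]]); split.
  move=> x; exists (col x), (comp x); split; last by rewrite inE.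
  by apply: imset_f; rewrite inE.
move=> i; split.
  move=> _ _ /imsetP[x0 + ->] /imsetP[x1 + ->]; rewrite !inE => /eqP c0 /eqP c1.
  move=> /eqP neq x y; rewrite !inE => x0x x1y [p [ep [py size_p]]]; apply: neq.
  have xy : dle e n x y.
    by apply/dist_leP; exists p; do 2!split=> //; apply: Rle_trans le_rn.
  apply/setP=> z; rewrite !inE; apply: (same_connect R_sym).
  apply: (connect_trans x0x); rewrite R_sym; apply: (connect_trans x1y).
  rewrite R_sym; apply: connect1; rewrite /R xy (R_col _ _ x0x) (R_col _ _ x1y).
  by rewrite c0 c1 eqxx.
move=> _ /imsetP[x0 _ ->] x y; rewrite !inE => x0x x0y; apply/dist_leP.
apply: dle_leq (leqnSn _) (colP _ _ _).
by apply: connect_trans x0y; rewrite R_sym.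
Qed.
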